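(* Let $\eta,\sigma>0$, $a=-\eta/\sigma$, $b=\eta/\sigma$, and let $X^+$ be the reflected Brownian motion on $[a,b]$ with $X^+_0\in\{a,b\}$. With $\theta^*_j,e_j,T_j,N_t$ the functionals of the path of $X^+$ defined in the context, the following identity holds pathwise (almost surely), for all $t\ge0$: $$\gamma^+_{r^+_t}(a)-\gamma^+_{r^+_t}(b)=\sum_{j=1}^{N_t}\theta^*_j e_j+\theta^*_{N_t+1}\,\big(t-T_{N_t}\big).$$
   Context: Reflected Brownian motion and local times. $X^+=\{X^+_t\}_{t\ge0}$ is the reflected Brownian motion on $[a,b]$ (generator $\varphi''$), satisfying the Skorokhod decomposition $$X^+_t=X^+_0+B_t+\gamma^+_t(a)-\gamma^+_t(b),$$ where $B$ is a Brownian motion with variance $2t$ and $\gamma^+_t(a)$, $\gamma^+_t(b)$ are the continuous non-decreasing boundary local times at $a$ and $b$ (started at $0$, increasing only when $X^+$ is at $a$, respectively at $b$). The total boundary local time is $\gamma^+_t=\gamma^+_t(a)+\gamma^+_t(b)$, and $r^+_t:=\inf\{s\ge0:\gamma^+_s>t\}$, so $\gamma^+_{r^+_t}=t$. The midpoint of $[a,b]$ is $0$. Renewal structure. Set $T^*_0=T^*_0(\partial)=0$ and, for $j\ge1$, $$T^*_j:=\inf\{t>T^*_{j-1}(\partial): X^+_t=0\},\qquad T^*_j(\partial):=\inf\{t>T^*_j: X^+_t\in\{a,b\}\}.$$ For $j\ge1$, $$e_j:=\gamma^+_{T^*_j}-\gamma^+_{T^*_{j-1}(\partial)}=\gamma^+_{T^*_j}-\gamma^+_{T^*_{j-1}},\qquad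 \theta^*_j=\begin{cases}+1,& X^+_{T^*_{j-1}(\partial)}=a,\\ -1,& X^+_{T^*_{j-1}(\partial)}=b.\end{cases}$$ Further $T_0=0$, $T_n=\sum_{j=1}^n e_j=\gamma^+_{T^*_n}$ are the renewal epochs on the local time scale, and $N_t=\max\{n\ge0:T_n\le t\}$. *)

(* Defs.v *)
From HB Require Import structures.
From mathcomp Require Import all_boot all_order all_algebra.
From mathcomp Require Import all_classical all_reals all_analysis.

Set Implicit Arguments.
Unset Strict Implicit.
Unset Printing Implicit Defensive.

Import Order.TTheory GRing.Theory Num.Theory.
Import numFieldNormedType.Exports.

Local Open Scope classical_set_scope.
Local Open Scope ring_scope.

(* A process is a map [R -> T -> R] and a path a map [R -> R], in both cases
   with the time first; only the times [0 <= t] are ever constrained. *)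

Section Processes.
Context (R : realType) (d : measure_display) (T : measurableType d).
Implicit Types (F : R -> set_system T) (Z : R -> T -> R).

Definition filtration F : Prop :=
  [/\ forall t, 0 <= t -> sigma_algebra setT (F t),
      forall t, 0 <= t -> F t `<=` measurable &
      forall s t, 0 <= s -> s <= t -> F s `<=` F t].

Definition adapted F Z : Prop :=
  forall t, 0 <= t -> forall A : set R, measurable A -> F t (Z t @^-1` A).

Definition continuous_path (z : R -> R) : Prop :=
  {within `[0, +oo[, continuous z}.

Definition increment (Z : R -> T -> R) (s t : R) (w : T) : R := Z t w - Z s w.

(* The second parameter of [normal_prob] is the standard deviation, so the
   increments have variance [2 * (t - s)] (generator [phi'']). *)
Definition brownian_motion (P : probability T R) F (B : R -> T -> R) : Prop :=
  [/\ adapted F B,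
      {ae P, forall w, B 0 w = 0 /\ continuous_path (B ^~ w)},
      (forall s t, 0 <= s -> s < t -> forall A : set R, measurable A ->
        P (increment B s t @^-1` A) =
        normal_prob 0 (Num.sqrt (2 * (t - s))) A) &
      forall s t, 0 <= s -> s < t -> forall G : set T, F s G ->
        forall A : set R, measurable A ->
        P (G `&` increment B s t @^-1` A) =
        (P G * P (increment B s t @^-1` A))%E].

(* [g] is a continuous nondecreasing function started at 0 that increases only
   when [x] is at [c]: it is constant on every interval on which [x] avoids
   [c]. *)
Definition boundary_local_time (x : R -> R) (c : R) (g : R -> R) : Prop :=
  [/\ g 0 = 0,
      continuous_path g,
      forall s t, 0 <= s -> s <= t -> g s <= g t &
      forall s t, 0 <= s -> s <= t ->
        (forall u, s <= u -> u <= t -> x u != c) -> g t = g s].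

Definition skorokhod_decomposition (a b : R) (x beta ga gb : R -> R) : Prop :=
  [/\ continuous_path x,
      forall t, 0 <= t -> a <= x t <= b,
      forall t, 0 <= t -> x t = x 0 + beta t + ga t - gb t,
      boundary_local_time x a ga &
      boundary_local_time x b gb].

Definition reflected_brownian_motion (P : probability T R) F (a b : R)
    (X B ga gb : R -> T -> R) : Prop :=
  [/\ filtration F,
      brownian_motion P F B,
      [/\ adapted F X, adapted F ga & adapted F gb] &
      {ae P, forall w,
         skorokhod_decomposition a b (X ^~ w) (B ^~ w) (ga ^~ w) (gb ^~ w)}].

End Processes.

Section PathFunctionals.
Context (R : realType).

(* Hitting times take values in [\bar R], the infimum of the empty set being
   [+oo]. Where a path is evaluated at such a time the time is read through
   [fine]; for reflected Brownian motion the times below are a.s. finite. *)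
Definition hit_after (x : R -> R) (A : set R) (u : \bar R) : \bar R :=
  ereal_inf [set s%:E | s in [set s : R | [/\ 0 <= s, (u < s%:E)%E & A (x s)]]].

Variables (a b : R) (x ga gb : R -> R).

Definition gamma (t : R) : R := ga t + gb t.

Definition r_inv (t : R) : \bar R :=
  ereal_inf [set s%:E | s in [set s : R | 0 <= s /\ t < gamma s]].

Fixpoint Tbdry (j : nat) : \bar R :=
  if j is j'.+1 then
    hit_after x [set a; b] (hit_after x [set 0] (Tbdry j'))
  else 0%E.

Definition Tstar (j : nat) : \bar R :=
  if j is j'.+1 then hit_after x [set 0] (Tbdry j') else 0%E.

(* [excess] and [theta] are meant for [1 <= j] only. *)
Definition excess (j : nat) : R :=
  gamma (fine (Tstar j)) - gamma (fine (Tbdry j.-1)).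

Definition theta (j : nat) : R :=
  let y := x (fine (Tbdry j.-1)) in
  if y == a then 1 else if y == b then -1 else 0.

Definition Trenew (n : nat) : R := \sum_(1 <= j < n.+1) excess j.

(* The maximum of [{n | Trenew n <= t}], with value 0 if there is none. *)
Definition Ncount (t : R) : nat :=
  xget 0%N [set n : nat | Trenew n <= t /\
                          forall m, Trenew m <= t -> (m <= n)%N].

End PathFunctionals.

(* Main.v *)
(* Reflected Brownian motion is bounded while the driving Brownian motion is
   a.s. unbounded above and below, so both local times are unbounded and the
   path visits a, b, and hence 0, at arbitrarily large times: all the hitting
   times are finite and, by continuity, they do not accumulate. From one visit
   to the boundary until the next visit to 0 the path cannot reach the opposite
   endpoint, so only one of the two local times grows; from there until the next
   visit to the boundary neither does. Summing over the cycles gives the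
   identity at the renewal epochs, and the last term is the incomplete cycle
   that contains the inverse local time. *)
Require Import Defs.
From HB Require Import structures.
From mathcomp Require Import all_boot all_order all_algebra.
From mathcomp Require Import all_classical all_reals all_analysis.
From mathcomp Require Import measurable_realfun lra.

Set Implicit Arguments.
Unset Strict Implicit.
Unset Printing Implicit Defensive.

Import Order.TTheory GRing.Theory Num.Theory.
Import numFieldNormedType.Exports.

Local Open Scope classical_set_scope.
Local Open Scope ring_scope.

(** * Closed sets, intermediate values and hitting times for continuous paths *)

Section Paths.
Context (R : realType).
Implicit Types (x y : R -> R) (A : set R) (s t u v : R).

Lemma closure_inf A : A !=set0 -> has_lbound A -> closure A (inf A).
Proof.
move=> A0 lA V /nbhs_ballP[e /= e0 eV].
have [z Az ze] := inf_adherent e0 (conj A0 lA).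
exists z; split => //; apply: eV.
have := ge_inf lA Az.
by rewrite /ball /= ltr_distl; lra.
Qed.

Lemma closed_path_preimage x A : continuous_path x -> closed A ->
  closed [set s | 0 <= s /\ A (x s)].
Proof.
move=> cx cA; have /continuous_closedP/(_ A cA)/closed_subspaceP[V cV VE] := cx.
have -> : [set s | 0 <= s /\ A (x s)] = V `&` `[0, +oo[.
  rewrite VE; apply/seteqP; split=> s /=; rewrite in_itv /= andbT; tauto.
by apply: closedI => //; exact: interval_closed.
Qed.

Lemma path_IVT x s t v : continuous_path x -> 0 <= s -> s <= t ->
  Num.min (x s) (x t) <= v <= Num.max (x s) (x t) ->
  exists2 u, s <= u <= t & x u = v.
Proof.
move=> cx s0 st xv.
have cst : {within `[s, t], continuous x}.
  apply: continuous_subspaceW cx => u /=; rewrite !in_itv /= andbT.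
  by move=> /andP[su _]; exact: le_trans su.
by have [u] := IVT st cst xv; rewrite in_itv /=; exists u.
Qed.

Lemma ereal_inf_closed A : closed A -> A !=set0 -> has_lbound A ->
  exists r, [/\ ereal_inf [set s%:E | s in A] = r%:E, A r & lbound A r].
Proof.
move=> cA A0 lA; exists (inf A); split; first exact: ereal_inf_EFin.
  by apply: cA; exact: closure_inf.
by move=> s As; exact: ge_inf.
Qed.

(** Because [A (x u)] fails, replacing [u < s] by [u <= s] leaves the set of hitting times
    unchanged; it is then closed, so the infimum is attained, and strictly after [u]. *)
Lemma hit_afterP x A u : continuous_path x -> closed A -> 0 <= u ->
    ~ A (x u) -> (exists2 s, u < s & A (x s)) ->
  exists r, [/\ hit_after x A u%:E = r%:E, u < r, A (x r) &
    forall s, u <= s -> s < r -> ~ A (x s)].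
Proof.
move=> cx cA u0 Axu [s us Axs].
have SE : [set s | [/\ 0 <= s, (u%:E < s%:E)%E & A (x s)]] =
    [set s | 0 <= s /\ A (x s)] `&` `[u, +oo[.
  apply/seteqP; split=> v /=; rewrite in_itv /= andbT lte_fin.
    by case=> ? /ltW.
  move=> [[v0 Axv]]; rewrite le_eqVlt => /predU1P[uv|//].
  by move: Axu; rewrite uv.
rewrite /hit_after SE.
have [] := @ereal_inf_closed ([set s | 0 <= s /\ A (x s)] `&` `[u, +oo[).
- apply: closedI; [exact: closed_path_preimage | exact: interval_closed].
- by rewrite -SE; exists s; rewrite /= lte_fin; split=> //; lra.
- by exists u => v /=; rewrite in_itv /= andbT => -[].
move=> r [-> + lr]; rewrite -SE /= lte_fin => -[r0 ur Axr].
exists r; split=> // v uv vr Axv.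
suff : r <= v by rewrite leNgt vr.
by apply: lr; rewrite /= in_itv /= andbT; split=> //; split=> //; lra.
Qed.

End Paths.

(** * Functions that grow only while the path sits at a given level *)

Section LocalTime.
Context (R : realType) (x : R -> R) (c : R) (g : R -> R).
Implicit Types (s t u v : R).
Hypothesis ltg : boundary_local_time x c g.

(** Otherwise [x] avoids [c] from [s + 1] on, so that [g] stays at [g (s + 1)] and is bounded. *)
Lemma local_time_unbounded_hits :
  (forall K, exists2 t, 0 <= t & K < g t) ->
  forall s, 0 <= s -> exists2 u, s < u & x u = c.
Proof.
case: ltg => _ _ mono flat gy s s0; apply: contrapT => noc.
have [t t0 gt] := gy (g (s + 1)).
have s1 : 0 <= s + 1 by lra.
have [ts|/ltW st] := leP t (s + 1).
  by have := mono _ _ t0 ts; lra.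
suff e : g t = g (s + 1) by move: gt; rewrite e ltxx.
apply: flat => // u su _; apply/eqP => xu; apply: noc.
by exists u => //; lra.
Qed.

(** This allows [x v = c]: if [g v > g s], the midpoint value is taken at some [u < v], although [g]
    is flat on the closed interval from [s] to [u]. *)
Lemma local_time_flat_right_open s v : 0 <= s -> s <= v ->
  (forall u, s <= u -> u < v -> x u != c) -> g v = g s.
Proof.
case: ltg => _ cg mono flat s0 sv noc.
have := mono _ _ s0 sv; rewrite le_eqVlt => /predU1P[//|lt].
have [|u /andP[su uv] gu] := @path_IVT R g s v ((g s + g v) / 2) cg s0 sv.
  by rewrite (min_idPl (ltW lt)) (max_idPr (ltW lt)); lra.
have uneqv : u < v.
  by rewrite lt_neqAle uv andbT; apply/eqP => e; rewrite e in gu; lra.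
suff : g u = g s by lra.
by apply: flat => // w sw wu; apply: noc => //; exact: le_lt_trans uneqv.
Qed.

End LocalTime.

(** * The inverse of the total local time *)

Section Inverse.
Context (R : realType) (ga gb : R -> R).
Implicit Types (r s t u v : R).
Local Notation g := (gamma ga gb).
Hypotheses (cg : continuous_path g) (g0 : g 0 = 0).

Lemma r_invP t : 0 <= t -> (exists2 s, 0 <= s & t < g s) ->
  exists r, [/\ r_inv ga gb t = r%:E, 0 <= r, g r = t,
    forall u, 0 <= u -> t < g u -> r <= u &
    forall u, (forall s, 0 <= s -> t < g s -> u <= s) -> u <= r].
Proof.
move=> t0 [s s0 ts]; pose S := [set s | 0 <= s /\ t < g s].
have S0 : S !=set0 by exists s.
have lS : has_lbound S by exists 0 => u [].
have infS u : 0 <= u -> t < g u -> inf S <= u.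
  by move=> u0 tu; exact: ge_inf.
have inf0 : 0 <= inf S by apply: lb_le_inf => // u [].
exists (inf S); split => //.
- exact: ereal_inf_EFin.
- apply/eqP; rewrite eq_le; apply/andP; split.
    (* If [g] exceeded [t] at the infimum, an intermediate value above [t] would be taken at a
       strictly earlier time. *)
    rewrite leNgt; apply/negP => tr.
    have [|u /andP[u0 ur] gu] :=
        @path_IVT R g 0 (inf S) ((t + g (inf S)) / 2) cg (lexx _) inf0.
      by rewrite g0 (min_idPl (ltW _)) ?(max_idPr (ltW _)); lra.
    have : inf S <= u by apply: infS; lra.
    by move=> ru; have e : u = inf S by [lra]; rewrite e in gu; lra.
  have cS : closed [set s | 0 <= s /\ [set` `[t, +oo[] (g s)].
    by apply: closed_path_preimage => //; exact: interval_closed.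
  have [|_] := cS (inf S); last by rewrite /= in_itv /= andbT.
  have := closure_inf S0 lS; apply: closure_subset => u [u0 tu].
  by split=> //; rewrite /= in_itv /= andbT ltW.
- by move=> u hu; apply: lb_le_inf => // v [v0 tv]; exact: hu.
Qed.

End Inverse.

(** * Cycles from an endpoint to 0 and back, for a single fixed path *)

Section Cycles.
Context (R : realType) (a b : R) (x beta ga gb : R -> R).
Hypotheses (a0 : a < 0) (b0 : 0 < b :> R)
  (skor : skorokhod_decomposition a b x beta ga gb)
  (x0 : x 0 = a \/ x 0 = b)
  (beta_up : forall K : R, exists n : nat, K < beta n%:R)
  (beta_down : forall K : R, exists n : nat, K < - beta n%:R).

Implicit Types (c r s t u v w : R).

Local Notation g := (gamma ga gb).
(** Cycle [j], counted from 0, runs from [tau j] through [sig j] to [tau j.+1]; its sign and its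
    local time are [theta] and [excess] at index [j.+1]. *)
Local Notation tau j := (fine (Tbdry a b x j)).
Local Notation sig j := (fine (Tstar a b x j.+1)).

Let ab : a <= b. Proof. exact: ltW (lt_trans a0 b0). Qed.
Let an0 : a <> 0. Proof. by apply/eqP; rewrite lt_eqF. Qed.
Let bn0 : b <> 0. Proof. by apply/eqP; rewrite gt_eqF. Qed.
Let cx : continuous_path x. Proof. by case: skor. Qed.
Let lta : boundary_local_time x a ga. Proof. by case: skor. Qed.
Let ltb : boundary_local_time x b gb. Proof. by case: skor. Qed.

Let local_time_ge0 c k t : boundary_local_time x c k -> 0 <= t -> 0 <= k t.
Proof. by move=> [k0 _ mono _] t0; rewrite -k0; exact: mono. Qed.

(** As [x] varies by at most [b - a] and [gb >= 0], the decomposition turns a very negative [beta]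
    into a large [ga]; an unbounded [ga] forces visits to [a]. *)
Lemma hits_a s : 0 <= s -> exists2 u, s < u & x u = a.
Proof.
apply: (local_time_unbounded_hits lta) => K.
have [n Kn] := beta_down (K + b - a); exists n%:R => //.
case: skor => _ xab xE _ _.
have := xE n%:R (ler0n _ n); have := xab n%:R (ler0n _ n).
have := xab 0 (lexx 0); have := local_time_ge0 ltb (ler0n R n).
by lra.
Qed.

Lemma hits_b s : 0 <= s -> exists2 u, s < u & x u = b.
Proof.
apply: (local_time_unbounded_hits ltb) => K.
have [n Kn] := beta_up (K + b - a); exists n%:R => //.
case: skor => _ xab xE _ _.
have := xE n%:R (ler0n _ n); have := xab n%:R (ler0n _ n).
have := xab 0 (lexx 0); have := local_time_ge0 lta (ler0n R n).
by lra.
Qed.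

Lemma gamma_unbounded t : exists2 s, 0 <= s & t < g s.
Proof.
have [n Kn] := beta_up (t + b - a); exists n%:R => //.
case: skor => _ xab xE _ _.
have := xE n%:R (ler0n _ n); have := xab n%:R (ler0n _ n).
have := xab 0 (lexx 0); have := local_time_ge0 lta (ler0n R n).
by rewrite /gamma; lra.
Qed.

Lemma gamma_mono s t : 0 <= s -> s <= t -> g s <= g t.
Proof.
case: lta => _ _ ma _; case: ltb => _ _ mb _ s0 st.
by apply: lerD; [exact: ma | exact: mb].
Qed.

Lemma gamma_continuous : continuous_path g.
Proof.
by case: lta => _ ca _ _; case: ltb => _ cb _ _; exact: within_continuousD.
Qed.

Lemma gamma0 : g 0 = 0.
Proof.
by case: lta => ga0 _ _ _; case: ltb => gb0 _ _ _; rewrite /gamma ga0 gb0 addr0.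
Qed.

Lemma hits_0 s : 0 <= s -> exists2 u, s < u & x u = 0.
Proof.
move=> s0; have [u su xu] := hits_a s0.
have u0 : 0 <= u by lra.
have [v uv xv] := hits_b u0.
have [|w /andP[uw _] xw] := @path_IVT R x u v 0 cx u0 (ltW uv).
  by rewrite xu xv (min_idPl ab) (max_idPr ab) (ltW a0) (ltW b0).
by exists w => //; lra.
Qed.

Let closed_ends : closed [set a; b].
Proof. by apply: closedU; exact: closed_eq. Qed.

Lemma cycle_exists u : 0 <= u -> x u = a \/ x u = b ->
  exists s v, [/\ hit_after x [set 0] u%:E = s%:E,
    hit_after x [set a; b] s%:E = v%:E, u < s /\ x s = 0 & s < v] /\
  [/\ x v = a \/ x v = b, (forall w, u <= w -> w < s -> x w <> 0) &
    (forall w, s <= w -> w < v -> x w != a /\ x w != b)].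
Proof.
move=> u0 xu.
have [|s [hs us xs ns]] :=
    hit_afterP cx (@closed_eq _ (0 : R)) u0 _ (hits_0 u0).
  by move=> /= xu0; case: xu; rewrite xu0 => /esym.
have s0 : 0 <= s by lra.
have [||v [hv sv xv nv]] := hit_afterP cx closed_ends s0.
- by move: xs => /= -> -[] /esym.
- by have [v sv xv] := hits_a s0; exists v => //; left.
exists s, v; do 2!split=> //.
by move=> w sw wv; split; apply/eqP => xw; apply: (nv w sw wv); [left|right].
Qed.

(** Finiteness of the boundary times makes reading them through [fine] harmless; each cycle ends at
    an endpoint, which lets the next one be built. *)
Lemma Tbdry_fin j :
  [/\ Tbdry a b x j = (tau j)%:E, 0 <= tau j & x (tau j) = a \/ x (tau j) = b].
Proof.
elim: j => [|j [jE j0 jx]]; first by [].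
have [s [v [[hs hv [us _] sv] [xv _ _]]]] := cycle_exists j0 jx.
have -> : Tbdry a b x j.+1 = v%:E by rewrite /= jE hs hv.
by split=> //=; lra.
Qed.

Lemma cycleP j : [/\ tau j < sig j, x (sig j) = 0, sig j < tau j.+1,
    (forall w, tau j <= w -> w < sig j -> x w <> 0) &
    (forall w, sig j <= w -> w < tau j.+1 -> x w != a /\ x w != b)].
Proof.
have [jE j0 jx] := Tbdry_fin j.
have [s [v [[hs hv [us xs] sv] [xv n0 nab]]]] := cycle_exists j0 jx.
have -> : Tstar a b x j.+1 = s%:E by rewrite /= jE hs.
by have -> : Tbdry a b x j.+1 = v%:E by rewrite /= jE hs hv.
Qed.

Lemma local_times_flat_until_return j :
  ga (tau j.+1) = ga (sig j) /\ gb (tau j.+1) = gb (sig j).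
Proof.
have [_ j0 _] := Tbdry_fin j; have [us _ sv _ nab] := cycleP j.
have s0 : 0 <= sig j by lra.
split; [apply: (local_time_flat_right_open lta) |
  apply: (local_time_flat_right_open ltb)] => //; try exact: ltW.
- by move=> w sw wv; case: (nab w sw wv).
- by move=> w sw wv; case: (nab w sw wv).
Qed.

(** The min-max condition places [c] and the starting endpoint strictly on opposite sides of 0, so
    reaching [c] requires a zero first; the first zero is at [sig j], where the path is at 0 and not
    at [c]. *)
Lemma other_end_avoided j c w :
  Num.min (x (tau j)) c < 0 < Num.max (x (tau j)) c ->
  tau j <= w -> w <= sig j -> x w != c.
Proof.
move=> c0 jw ws; apply/eqP => xw.
have [_ j0 _] := Tbdry_fin j; have [us xs sv n0 _] := cycleP j.
have [|z /andP[jz zw] xz] := @path_IVT R x (tau j) w 0 cx j0 jw.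
  by rewrite xw; case/andP: c0 => /ltW -> /ltW ->.
have zs : z = sig j.
  apply/eqP; rewrite eq_le (le_trans zw ws) /= leNgt; apply/negP => zs.
  exact: (n0 z).
have wE : w = sig j by apply/eqP; rewrite eq_le ws -zs zw.
move: c0; rewrite -xw wE xs; case/andP.
by case: (ltgtP (x (tau j)) 0); lra.
Qed.

(** Only the local time of the starting endpoint can grow on this stretch. Keeping [r] free serves
    both the complete cycles, with [r = sig j], and the last, incomplete one. *)
Lemma signed_local_time_until_zero j r : tau j <= r -> r <= sig j ->
  ga r - gb r = ga (tau j) - gb (tau j) + theta a b x j.+1 * (g r - g (tau j)).
Proof.
move=> jr rs; have [_ j0 jx] := Tbdry_fin j.
case: lta => _ _ _ fa; case: ltb => _ _ _ fb.
rewrite /theta /= /gamma; case: jx => jx.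
  have -> : gb r = gb (tau j).
    apply: fb => // w jw wr; apply: (@other_end_avoided j) => //.
      by rewrite jx (min_idPl ab) (max_idPr ab) a0.
    exact: le_trans wr rs.
  by rewrite jx eqxx; lra.
have -> : ga r = ga (tau j).
  apply: fa => // w jw wr; apply: (@other_end_avoided j) => //.
    by rewrite jx (min_idPr ab) (max_idPl ab) a0.
  exact: le_trans wr rs.
by rewrite jx eqxx gt_eqF ?(lt_trans a0 b0) //; lra.
Qed.

(** The excesses stop at [sig n] and resume at [tau n.+1]; the sum telescopes because the local
    times are flat in between. *)
Lemma TrenewE n : Trenew a b x ga gb n = g (tau n).
Proof.
elim: n => [|n IH]; first by rewrite /Trenew big_geq // gamma0.
rewrite /Trenew big_nat_recr //= -/(Trenew a b x ga gb n) IH /excess /=.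
have [ea eb] := local_times_flat_until_return n.
by rewrite -[in RHS]/(Tbdry a b x n.+1) /gamma ea eb /=; lra.
Qed.

Lemma signed_sumE n :
  \sum_(1 <= j < n.+1) theta a b x j * excess a b x ga gb j
    = ga (tau n) - gb (tau n).
Proof.
elim: n => [|n IH].
  case: lta => ga0 _ _ _; case: ltb => gb0 _ _ _.
  by rewrite big_geq //= ga0 gb0 subrr.
rewrite big_nat_recr //= IH.
have [ea eb] := local_times_flat_until_return n; have [us _ _ _ _] := cycleP n.
rewrite -[in RHS]/(Tbdry a b x n.+1) ea eb.
by rewrite (signed_local_time_until_zero (ltW us) (lexx _)).
Qed.

Lemma tau_mono : {homo (fun j => tau j) : m n / (m <= n)%N >-> m <= n}.
Proof.
apply: homo_leq => [//|y u v|j]; first exact: le_trans.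
by have [us _ sv _ _] := cycleP j; exact: ltW (lt_trans us sv).
Qed.

(* At an accumulation point the path would be both at 0 and at an endpoint. *)
Lemma tau_unbounded K : exists n, K < tau n.
Proof.
apply: contrapT => noK.
have ubK n : tau n <= K.
  by rewrite leNgt; apply/negP => Kn; apply: noK; exists n.
pose A := range (fun j => tau j); pose S := range (fun j => sig j).
have A0 : A !=set0 by exists (tau 0), 0%N.
have S0 : S !=set0 by exists (sig 0), 0%N.
have uA : has_ubound A by exists K => _ [n _ <-]; exact: ubK.
have uS : has_ubound S.
  exists K => _ [n _ <-]; have [_ _ sv _ _] := cycleP n.
  exact: le_trans (ltW sv) (ubK _).
(* The two sequences interlace, hence have the same supremum. *)
have supE : sup A = sup S.
  apply/eqP; rewrite eq_le; apply/andP; split; apply: ge_sup => // _ [n _ <-].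
    have [us _ _ _ _] := cycleP n; apply: le_trans (ltW us) _.
    by apply: ub_le_sup => //; exists n.
  have [_ _ sv _ _] := cycleP n; apply: le_trans (ltW sv) _.
  by apply: ub_le_sup => //; exists n.+1.
have clA := closed_path_preimage cx closed_ends.
have clS := closed_path_preimage cx (@closed_eq _ (0 : R)).
have [|_] := clA (sup A).
  have := closure_sup A0 uA; apply: closure_subset => _ [n _ <-].
  by have [_ j0 jx] := Tbdry_fin n.
have [|_ /= ->] := clS (sup A); last by move=> -[] /esym.
have := closure_sup S0 uS; rewrite -supE; apply: closure_subset => _ [n _ <-].
have [_ j0 _] := Tbdry_fin n; have [us xs _ _ _] := cycleP n.
by split => //; lra.
Qed.

Lemma Trenew_mono : {homo Trenew a b x ga gb : m n / (m <= n)%N >-> m <= n}.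
Proof.
move=> m n mn; rewrite !TrenewE; have [_ m0 _] := Tbdry_fin m.
by apply: gamma_mono => //; exact: tau_mono.
Qed.

Lemma NcountP t : 0 <= t ->
  Trenew a b x ga gb (Ncount a b x ga gb t) <= t
    < Trenew a b x ga gb (Ncount a b x ga gb t).+1.
Proof.
move=> t0; rewrite /Ncount.
set M := [set n | _].
(* A maximum exists, so the default of [xget] is never taken: index 0 qualifies, and some renewal
   epoch exceeds [t] because [g] and [tau] are unbounded. *)
have : exists n, M n.
  have [s s0 ts] := gamma_unbounded t; have [n0 sn0] := tau_unbounded s.
  have Tn0 : t < Trenew a b x ga gb n0.
    rewrite TrenewE; apply: lt_le_trans ts _.
    by apply: gamma_mono => //; exact: ltW.
  have ex0 : exists n, Trenew a b x ga gb n <= t.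
    by exists 0%N; rewrite /Trenew big_geq.
  have ubT n : Trenew a b x ga gb n <= t -> (n <= n0)%N.
    apply: contraTT; rewrite -ltnNge -ltNge => /ltnW /Trenew_mono.
    exact: lt_le_trans.
  by case: (ex_maxnP ex0 ubT) => n Tn maxn; exists n; split.
move=> /(xgetPex 0%N); set N := xget _ _; move=> [-> maxN] /=.
by rewrite ltNge; apply/negP => /maxN; rewrite ltnn.
Qed.

Lemma signed_local_timeE t : 0 <= t ->
  let r := fine (r_inv ga gb t) in
  let N := Ncount a b x ga gb t in
  ga r - gb r =
    \sum_(1 <= j < N.+1) theta a b x j * excess a b x ga gb j
    + theta a b x N.+1 * (t - Trenew a b x ga gb N).
Proof.
move=> t0 /=; have /andP[] := NcountP t0; set N := Ncount _ _ _ _ _ _.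
rewrite !TrenewE => leN ltN.
have [r [-> r0 gr rmin rmax]] :=
  r_invP gamma_continuous gamma0 t0 (gamma_unbounded t).
have [_ j0 _] := Tbdry_fin N; have [us _ _ _ _] := cycleP N.
rewrite signed_sumE /= -[X in X - g _]gr; apply: signed_local_time_until_zero.
(* [g] is at most [t] up to [tau N], so every time with [g] above [t] comes later. *)
- apply: rmax => s s0 ts; rewrite leNgt; apply/negP => /ltW sN.
  by have := gamma_mono s0 sN; lra.
(* Here [g (sig N) = g (tau N.+1) > t], so the inverse is at most the zero of the cycle. *)
- have [ea eb] := local_times_flat_until_return N; apply: rmin; first lra.
  by move: ltN; rewrite /gamma ea eb.
Qed.

End Cycles.

(** * A recurrence criterion for adapted processes in discrete time *)

Section Recurrence.
Context d (T : measurableType d) (R : realType) (P : probability T R).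

Lemma cvg_fine_nonincreasing (E : (set T)^nat) :
    (forall n, measurable (E n)) -> nonincreasing_seq E ->
  fine (P (E n)) @[n --> \oo] --> fine (P (\bigcap_n E n)).
Proof.
move=> mE niE; apply: fine_cvg; rewrite fineK.
  apply: nonincreasing_cvg_mu => //; last exact: bigcapT_measurable.
  by apply: le_lt_trans (probability_le1 _ _) _ => //; exact: ltry.
by apply: fin_num_measure; exact: bigcapT_measurable.
Qed.

(* If the level [K] is never exceeded then, for every [n], either [Z n] is very
   negative or a later increment above [n] is not large; the latter costs a
   factor [1 - c], whatever happened up to time [n]. *)
Lemma ae_unbounded_above (F : nat -> set_system T) (Z : nat -> T -> R) (c : R) :
  0 < c ->
  (forall n, sigma_algebra setT (F n)) ->
  (forall n, F n `<=` d.-measurable) ->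
  (forall m n, (m <= n)%N -> F m `<=` F n) ->
  (forall n A, measurable A -> F n (Z n @^-1` A)) ->
  (forall n L, exists m, forall G, F n G ->
    (c%:E * P G <= P (G `&` [set w | (L < Z m w - Z n w)%R]))%E) ->
  {ae P, forall w K, exists n, K < Z n w}.
Proof.
move=> c0 sF mF leF adF jump.
have mZ n A : measurable A -> d.-measurable (Z n @^-1` A).
  by move=> mA; exact: (mF n _ (adF n A mA)).
have mZfun n : measurable_fun setT (Z n).
  by move=> _ A mA; rewrite setTI; exact: mZ.
(* Each level can be treated separately, since the natural levels are countable and cofinal. *)
suff below K : P [set w | forall n, Z n w <= K] = 0%E.
  have : {ae P, forall w (k : nat), exists n, k%:R < Z n w}.
    apply: ae_foralln => k; exists [set w | forall n, Z n w <= k%:R].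
    split; last 1 first.
    - move=> w /= h n; rewrite leNgt; apply/negP => kZ.
      by apply: h; exists n.
    - rewrite [X in measurable X](_ : _ = \bigcap_n (Z n @^-1` `]-oo, k%:R])).
        by apply: bigcapT_measurable => n; apply: mZ.
      apply/seteqP; split=> w /= h n; first by rewrite /= in_itv /=.
      by have := h n I; rewrite /= in_itv.
    - exact: below.
  apply: filterS => w h K; have [n Kn] := h (Num.truncn `|K|).+1.
  exists n; apply: lt_trans Kn; apply: le_lt_trans (ler_norm K) _.
  exact: truncnS_gt.
pose E n := [set w | forall i, (i <= n)%N -> Z i w <= K].
have FE n : F n (E n).
  have [F0 FC FU] := sF n.
  rewrite [E n](_ : _ = setT `\`
    \bigcup_i (if (i <= n)%N then Z i @^-1` `]K, +oo[ else set0)).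
    apply: FC; apply: FU => i; case: ifP => // lein.
    by apply: (leF _ _ lein); exact: adF.
  apply/seteqP; split=> w /=.
    move=> h; split=> // -[i _]; case: ifP => // lein /=.
    by rewrite in_itv /= andbT ltNge h.
  move=> [_ h] i lein; rewrite leNgt; apply/negP => Ki.
  apply: h; exists i => //.
  by rewrite lein /= in_itv /= Ki.
have mE n : measurable (E n) by exact: mF.
have capE : [set w | forall n, Z n w <= K] = \bigcap_n E n.
  apply/seteqP; split=> w /= h n; first by move=> _ i _.
  exact: (h n I n (leqnn n)).
have mcapE : measurable (\bigcap_n E n) by exact: bigcapT_measurable.
rewrite capE.
pose p := fine (P (\bigcap_n E n)).
have PE A : measurable A -> P A = (fine (P A))%:E.
  by move=> mA; rewrite fineK // fin_num_measure.
pose Q n k := Z n @^-1` `]-oo, - (k%:R : R)[.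
have mQ n k : measurable (Q n k) by exact: mZ.
(* Off [Q n k] one has [Z n >= - k], so an increment above [K + k] would carry the process over [K]:
   staying below means missing [D]. *)
have step n k : p <= fine (P (Q n k)) + (1 - c) * fine (P (E n)).
  have [m /(_ _ (FE n))] := jump n (K + k%:R).
  set D := [set w | _] => cD.
  have mD : measurable D.
    rewrite [D](_ : _ = (Z m \- Z n) @^-1` `]K + k%:R, +oo[).
      have : measurable_fun setT (Z m \- Z n) by exact: measurable_funB.
      by move=> /(_ measurableT `]K + k%:R, +oo[%classic); rewrite setTI; apply.
    by apply/seteqP; split=> w /=; rewrite in_itv /= andbT.
  have sub : \bigcap_n E n `<=` Q n k `|` (E n `\` D).
    move=> w h; have [lt|ge] := ltP (Z n w) (- k%:R); [left|right].
      by rewrite /Q /= in_itv.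
    split; first exact: h.
    by rewrite /D /= => Dw; have := h m I m (leqnn m); lra.
  have le3 : (P (\bigcap_n E n) <= P (Q n k) + P (E n `\` D))%E.
    apply: le_trans (measureU2 _ _ _) => //; last exact: measurableD.
    apply: le_measure => //; rewrite inE //.
    by apply: measurableU => //; exact: measurableD.
  have eq2 : P (E n) = (P (E n `\` D) + P (E n `&` D))%E by exact: measureDI.
  have mED : d.-measurable (E n `\` D) by exact: measurableD.
  have mEI : d.-measurable (E n `&` D) by exact: measurableI.
  rewrite (PE _ mcapE) (PE _ (mQ n k)) (PE _ mED) -EFinD lee_fin in le3.
  rewrite (PE _ (mE n)) (PE _ mED) (PE _ mEI) -EFinD in eq2.
  rewrite (PE _ (mE n)) (PE _ mEI) -EFinM lee_fin in cD.
  by case: eq2 => eq2; rewrite /p; lra.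
have Qlim n : fine (P (Q n k)) @[k --> \oo] --> (0 : R).
  have := @cvg_fine_nonincreasing (Q n) (mQ n).
  rewrite [X in P X](_ : _ = set0).
    rewrite measure0 /=; apply.
    move=> k l kl; apply/subsetPset => w; rewrite /Q /= !in_itv /=.
    by move=> /lt_le_trans; apply; rewrite lerN2 ler_nat.
  rewrite -subset0 => w /(_ (Num.truncn `|Z n w|).+1 I).
  rewrite /Q /= in_itv /= ltrNr => h; have := truncnS_gt `|Z n w|.
  by have := ler_norm (- Z n w); rewrite normrN; lra.
(* First [k] tends to infinity with [n] fixed, then [n] does. The outcome [p <= (1 - c) * p] forces
   [p = 0]. *)
have step' n : p <= (1 - c) * fine (P (E n)).
  rewrite -[leRHS]add0r.
  have hl : fine (P (Q n k)) + (1 - c) * fine (P (E n)) @[k --> \oo]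
      --> 0 + (1 - c) * fine (P (E n)).
    by apply: cvgD => //; exact: cvg_cst.
  by apply: (cvgr_to_ge hl); apply: nearW => k; exact: step.
have hp : p <= (1 - c) * p.
  have hl : (1 - c) * fine (P (E n)) @[n --> \oo] --> (1 - c) * p.
    apply: cvgMr; apply: cvg_fine_nonincreasing => // k l kl.
    by apply/subsetPset => w /= h i ik; apply: h; exact: leq_trans kl.
  by apply: (cvgr_to_ge hl); apply: nearW => k; exact: step'.
have p0 : 0 <= p by exact: fine_ge0.
rewrite PE //; congr (_%:E); apply/eqP; rewrite eq_le p0 andbT.
have := mulr_ge0 (ltW c0) p0 => cp0.
by rewrite -(pmulr_rle0 _ c0) -/p; lra.
Qed.

End Recurrence.

(** * Brownian motion is unbounded in both directions along integer times *)

Section Brownian.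
Context d (T : measurableType d) (R : realType) (P : probability T R).

(** The interval lies within two standard deviations of the mean, where the density is at least
    [normal_peak 1 * expR (- 2) / s]; the length [s] cancels, so the bound is uniform in [s], as the
    recurrence criterion requires. *)
Lemma normal_prob_itv_ge (s u : R) : 0 < s -> - (2 * s) <= u -> u <= s ->
  ((normal_peak 1 * expR (- 2))%:E <= normal_prob 0 s `]u, (u + s)%R[)%E.
Proof.
move=> s0 su us; rewrite /normal_prob.
pose c : R := normal_peak 1 * expR (- 2).
have pdf_ge x : u < x < u + s -> c / s <= normal_pdf 0 s x.
  move=> /andP[ux xu]; rewrite normal_pdfE ?gt_eqF // /normal_fun subr0.
  have -> : normal_peak s = normal_peak 1 / s.
    rewrite /normal_peak expr1n mul1r -mulrnAr sqrtrM ?sqr_ge0 //.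
    by rewrite sqrtr_sqr gtr0_norm // invfM mulrC.
  rewrite /c mulrAC; apply: ler_wpM2l.
    by apply: divr_ge0; [exact: normal_peak_ge0 | exact: ltW].
  rewrite ler_expR mulNr lerN2 -mulr_natr ler_pdivrMr ?mulr_gt0 ?exprn_gt0 //.
  have : 0 <= (2 * s - x) * (2 * s + x) by apply: mulr_ge0; lra.
  by rewrite !expr2; lra.
rewrite -/c; apply: (@le_trans _ _
    (\int[lebesgue_measure]_(x in `]u, (u + s)%R[) (cst (c / s)%:E x))%E).
  rewrite integral_cst //= lebesgue_measure_itv /= lte_fin ltrDl s0.
  rewrite -EFinD -EFinM lee_fin.
  by rewrite addrAC subrr add0r divfK // gt_eqF.
apply: ge0_le_integral => //=.
- move=> x _; rewrite lee_fin; apply: divr_ge0; last exact: ltW.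
  by apply: mulr_ge0; [exact: normal_peak_ge0 | exact: expR_ge0].
- apply/measurable_EFinP; apply: measurable_funTS.
  exact: measurable_normal_pdf.
Qed.

Context (F : R -> set_system T) (B : R -> T -> R).
Hypotheses (filF : filtration F) (bmB : brownian_motion P F B).

Lemma brownian_motion_unbounded (e : R) : e = 1 \/ e = - 1 ->
  {ae P, forall w K, exists n : nat, K < e * B n%:R w}.
Proof.
move=> e1; case: filF => sF mF leF; case: bmB => adB _ normB indB.
have c0 : 0 < normal_peak 1 * expR (- 2) :> R.
  by rewrite mulr_gt0 ?expR_gt0 // normal_peak_gt0 // oner_eq0.
apply: (@ae_unbounded_above _ _ _ P (fun n => F n%:R)
  (fun n w => e * B n%:R w) _ c0).
- by move=> n; exact: sF.
- by move=> n; exact: mF.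
- by move=> m n mn; apply: leF => //; rewrite ler_nat.
- move=> n A mA.
  have -> : (fun w => e * B n%:R w) @^-1` A = B n%:R @^-1` ( *%R e @^-1` A).
    by [].
  apply: adB => //.
  have : measurable_fun setT ( *%R e : R -> R) by exact: mulrl_measurable.
  by move=> /(_ measurableT A mA); rewrite setTI.
(* With [k > L ^ 2] the standard deviation [sqrt (2 * k)] of the increment is at least [L]. *)
move=> n L; pose k := (Num.truncn (L ^+ 2)).+1; exists (n + k)%N => G FG.
have nk : (n%:R : R) < (n + k)%:R by rewrite ltr_nat -[ltnLHS]addn0 ltn_add2l.
set s : R := Num.sqrt (2 * ((n + k)%:R - n%:R)).
have sk : s = Num.sqrt (2 * k%:R) by rewrite /s natrD addrAC subrr add0r.
have s0 : 0 < s by rewrite sk sqrtr_gt0 mulr_gt0 // ltr0n.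
have Ls : L <= s.
  apply: le_trans (ler_norm L) _; rewrite -sqrtr_sqr sk ler_wsqrtr //.
  have := truncnS_gt (L ^+ 2); rewrite -/k; have : 0 <= (k%:R : R) by [].
  by lra.
(* The interval from [u] to [u + s] holds the increments of size between [s] and [2 * s] in the
   direction [e]. *)
pose u := if e == 1 then s else - (2 * s).
have mI : measurable (`]u, u + s[ : set R) by exact: measurable_itv.
have mB m : measurable_fun setT (B m%:R).
  by move=> _ A mA; rewrite setTI; apply: (mF m%:R) => //; exact: adB.
have mincrB : measurable_fun setT (increment B n%:R (n + k)%:R).
  exact: measurable_funB.
have mincr : d.-measurable (increment B n%:R (n + k)%:R @^-1` `]u, u + s[).
  by rewrite -[X in measurable X]setTI; exact: mincrB.
have mG : d.-measurable G by exact: mF FG.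
apply: (@le_trans _ _
    (P (G `&` increment B n%:R (n + k)%:R @^-1` `]u, (u + s)%R[)))%E.
  rewrite indB // muleC lee_wpmul2l // normB //.
  by apply: normal_prob_itv_ge => //; rewrite /u -/s; case: ifP => _; lra.
apply: le_measure; rewrite ?inE.
- exact: measurableI.
- apply: measurableI => //.
  rewrite [X in measurable X](_ : _ =
      (fun w => e * increment B n%:R (n + k)%:R w) @^-1` `]L, +oo[); last first.
    by apply/seteqP; split=> w; rewrite /= in_itv /= andbT /increment mulrBr.
  by rewrite -[X in measurable X]setTI; exact: measurable_funM.
- apply: setIS => w; rewrite /increment /= in_itv /= /u -mulrBr.
  case: e1 => -> ; first by rewrite eqxx mul1r; lra.
  by rewrite ifF ?lt_eqF//; lra.
Qed.

End Brownian.

(** * Passage from single paths to the almost sure identity *)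

Theorem theorem5 (R : realType) (d : measure_display) (T : measurableType d)
    (P : probability T R) (F : R -> set_system T)
    (eta sigma a b : R) (X B ga gb : R -> T -> R)
    (heta : 0 < eta) (hsigma : 0 < sigma)
    (ha : a = - eta / sigma) (hb : b = eta / sigma)
    (hX : reflected_brownian_motion P F a b X B ga gb)
    (hX0 : {ae P, forall w, X 0 w = a \/ X 0 w = b}) :
  {ae P, forall w, forall t : R, 0 <= t ->
    let x := X ^~ w in let gaw := ga ^~ w in let gbw := gb ^~ w in
    let r := fine (r_inv gaw gbw t) in
    let N := Ncount a b x gaw gbw t in
    gaw r - gbw r =
      \sum_(1 <= j < N.+1) theta a b x j * excess a b x gaw gbw j
      + theta a b x N.+1 * (t - Trenew a b x gaw gbw N)}.
Proof.
have b0 : 0 < b by rewrite hb divr_gt0.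
have a0 : a < 0 by rewrite ha mulNr oppr_lt0 -hb.
case: hX => filF bmB _ skor.
have up := brownian_motion_unbounded filF bmB (or_introl erefl).
have down := brownian_motion_unbounded filF bmB (or_intror erefl).
(* The exceptional null set comes from four almost sure properties that do not mention [t], so it
   serves all [t] at once. *)
apply: filterS3 hX0 skor (filterI up down) => w x0 skorw [upw downw] t t0.
apply: (signed_local_timeE a0 b0 skorw x0) => // K.
  by have [n Kn] := upw K; exists n; rewrite mul1r in Kn.
by have [n Kn] := downw K; exists n; rewrite mulN1r in Kn.
Qed.
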